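(* The collection $\mathfrak{R}$ is the smallest collection of metric families that is stable under regular decomposition and contains the collection $\mathfrak{B}$ of all bounded metric families. More specifically, (1) if a metric family $\mathcal{X}$ regularly decomposes over $\mathfrak{R}$, then $\mathcal{X}$ is in $\mathfrak{R}$; and (2) if $\mathfrak{C}$ is a collection of metric families that is stable under regular decomposition and contains $\mathfrak{B}$, then $\mathfrak{R}$ is contained in $\mathfrak{C}$.
   Context: A metric family is a set of metric spaces. A map of metric families $F\colon\mathcal{X}\to\mathcal{Y}$ is a collection of functions $f\colon X\to Y$ with $X\in\mathcal{X}$, $Y\in\mathcal{Y}$, such that each element of $\mathcal{X}$ is the domain of at least one function in $F$. $F$ is coarse if there is a non-decreasing function $\rho\colon[0,\infty)\to[0,\infty)$ with $d_Y(f(x),f(y))\le\rho(d_X(x,y))$ for all $f\colon X\to Y$ in $F$ and $x,y\in X$. A subfamily of $\mathcal{Y}$ is a metric family each of whose members is a subspace of some $Y\in\mathcal{Y}$; the inverse image of a subfamily $\mathcal{B}$ is $F^{-1}(\mathcal{B})=\{f^{-1}(B)\mid B\in\mathcal{B},\ f\in F\}$ (where $B$ is a subspace of the codomain of $f$). $\mathcal{X}$ is bounded if $\sup_{X\in\mathcal{X}}\operatorname{diam}X<\infty$; $\mathfrak{B}$ denotes the collection of all bounded metric families. $\operatorname{asdim}(\mathcal{X})\le n$ means: for every $r>0$, each $X\in\mathcal{X}$ has a decomposition $X=X_0\cup\dots\cup X_n$ where each $X_i$ is a union of subspaces $X_{ij}$, $j\in J_i$, with $d(x,y)>r$ whenever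 $x\in X_{ij}$, $y\in X_{ij'}$, $j\ne j'$, such that the family of all $X_{ij}$ (over all $X$, $i$, $j$) is bounded. $\mathcal{X}$ has finite asymptotic dimension if $\operatorname{asdim}(\mathcal{X})\le n$ for some $n$. $\mathcal{X}$ regularly decomposes over a collection $\mathfrak{C}$ of metric families if there are a metric family $\mathcal{Y}$ with finite asymptotic dimension and a coarse map $F\colon\mathcal{X}\to\mathcal{Y}$ such that $F^{-1}(\mathcal{B})\in\mathfrak{C}$ for every bounded subfamily $\mathcal{B}$ of $\mathcal{Y}$. $\mathfrak{C}$ is stable under regular decomposition if every metric family that regularly decomposes over $\mathfrak{C}$ is in $\mathfrak{C}$. Let $\mathfrak{R}_0=\mathfrak{B}$. For an ordinal $\alpha>0$, $\mathfrak{R}_\alpha$ is the collection of metric families that regularly decompose over $\bigcup_{\beta<\alpha}\mathfrak{R}_\beta$, meaning: $\mathcal{X}\in\mathfrak{R}_\alpha$ if there are a metric family $\mathcal{Y}$ with finite asymptotic dimension and a coarse map $F\colon\mathcal{X}\to\mathcal{Y}$ such that for every bounded subfamily $\mathcal{B}$ of $\mathcal{Y}$ there is an ordinal $\beta<\alpha$ with $F^{-1}(\mathcal{B})\in\mathfrak{R}_\beta$. $\mathfrak{R}$ is the collection of metric families that belong to $\mathfrak{R}_\alpha$ for some countable ordinal $\alpha$. *)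

(* Defs.v *)
From HB Require Import structures.
From mathcomp Require Import all_boot all_order all_algebra.
From mathcomp Require Import all_classical all_reals.
From mathcomp Require Import ereal topology wochoice.

Set Implicit Arguments.
Unset Strict Implicit.
Unset Printing Implicit Defensive.

Import Order.TTheory GRing.Theory Num.Theory.

Local Open Scope classical_set_scope.
Local Open Scope ring_scope.

(* [set_type A] already carries the initial uniform structure, so the induced
   metric is put on an alias. *)
Definition subspace_type (R : realType) (X : metricType R) (A : set X) : Type :=
  set_type A.

Section subspace_metric.
Context {R : realType} {X : metricType R} (A : set X).

HB.instance Definition _ := Choice.copy (subspace_type A) (set_type A).

Let dist (x y : subspace_type A) : R := mdist (val x) (val y).

Let dist_xx x : dist x x = 0. Proof. exact: mdistxx. Qed.

Let dist_eq0 x y : dist x y = 0 -> x = y.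
Proof. by move=> /mdist_positivity /val_inj. Qed.

Let dist_sym x y : dist x y = dist y x. Proof. exact: metric_sym. Qed.

Let dist_triangle y x z : dist x z <= dist x y + dist y z.
Proof. exact: metric_triangle. Qed.

HB.instance Definition _ := isMetric.Build R (subspace_type A)
  dist_xx dist_eq0 dist_sym dist_triangle.

End subspace_metric.

Definition metric_subspace (R : realType) (X : metricType R) (A : set X) :
  metricType R := subspace_type A.

(* [metricType R] is too large a type for [set], hence the explicit arrow. *)
Definition metric_family (R : realType) := metricType R -> Prop.

Definition collection (R : realType) := metric_family R -> Prop.

Definition contained (R : realType) (CC DD : collection R) : Prop :=
  forall XX, CC XX -> DD XX.

(* [F X Y f] means that [f : X -> Y] is one of the functions of the family. *)
Definition function_family (R : realType) :=
  forall X Y : metricType R, set (X -> Y).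

(* [BB Y A] means that the subset [A] of [Y], seen as a subspace of [Y], is one
   of the members of the family; see [members_of]. *)
Definition subspace_family (R : realType) :=
  forall Y : metricType R, set (set Y).

Section families.
Context {R : realType}.
Implicit Types (XX YY : metric_family R) (F : function_family R)
  (BB : subspace_family R) (CC : collection R).

Definition family_map XX YY F : Prop :=
  (forall X Y f, F X Y f -> XX X /\ YY Y) /\
  (forall X, XX X -> exists Y f, F X Y f).

Definition coarse F : Prop :=
  exists rho : R -> R,
    [/\ forall t, 0 <= t -> 0 <= rho t,
        forall s t, 0 <= s -> s <= t -> rho s <= rho t &
        forall X Y f, F X Y f ->
          forall x y, mdist (f x) (f y) <= rho (mdist x y)].

Definition subfamily YY BB : Prop := forall Y A, BB Y A -> YY Y.

Definition members_of BB : metric_family R :=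
  fun Z => exists (Y : metricType R) (A : set Y),
    BB Y A /\ Z = metric_subspace A.

Definition inverse_image F BB : metric_family R :=
  fun Z => exists (X Y : metricType R) (f : X -> Y) (B : set Y),
    [/\ F X Y f, BB Y B & Z = metric_subspace (f @^-1` B)].

(* The diameter of the empty space is -oo, which does not affect boundedness. *)
Definition diam (X : metricType R) : \bar R :=
  ereal_sup [set (mdist p.1 p.2)%:E | p in [set: X * X]].

Definition bounded_family XX : Prop :=
  (ereal_sup [set d | exists X, XX X /\ d = diam X] < +oo)%E.

Definition asdim_le XX (n : nat) : Prop :=
  forall r : R, 0 < r ->
  exists (J : metricType R -> 'I_n.+1 -> Type)
         (P : forall (X : metricType R) (i : 'I_n.+1), J X i -> set X),
    [/\ forall X, XX X ->
          [set: X] = \bigcup_(i : 'I_n.+1) \bigcup_(j : J X i) P X i j,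
        forall X, XX X -> forall (i : 'I_n.+1) (j j' : J X i), j <> j' ->
          forall x y, P X i j x -> P X i j' y -> r < mdist x y &
        bounded_family
          (fun Z => exists (X : metricType R) (i : 'I_n.+1) (j : J X i),
                      XX X /\ Z = metric_subspace (P X i j))].

Definition finite_asdim XX : Prop := exists n, asdim_le XX n.

Definition regularly_decomposes CC XX : Prop :=
  exists (YY : metric_family R) (F : function_family R),
    [/\ finite_asdim YY, family_map XX YY F, coarse F &
        forall BB, subfamily YY BB -> bounded_family (members_of BB) ->
          CC (inverse_image F BB)].

Definition stable_under_regular_decomposition CC : Prop :=
  forall XX, regularly_decomposes CC XX -> CC XX.

End families.

(* An ordinal is represented by a well-ordered type having it as order type. *)
Record wo_type := WoType {
  wo_sort :> Type;
  wo_le : rel wo_sort;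
  wo_leP : well_order wo_le
}.

Definition wo_lt (a : wo_type) (x y : a) : Prop := wo_le x y /\ x <> y.

Definition ordinal_zero (a : wo_type) : Prop := [set: a] = set0.

(* [b] is isomorphic to a proper initial segment of [a]. *)
Definition ordinal_lt (b a : wo_type) : Prop :=
  exists (t : a) (f : b -> a),
    {mono f : x y / wo_le x y >-> wo_le x y} /\
    range f = [set x | wo_lt x t].

(* The transfinite recursion is rendered as an inductive predicate, which
   defines the same collections because [ordinal_lt] is well founded. *)
Inductive regdec_rank (R : realType) : wo_type -> collection R :=
| regdec_rank0 a XX :
    ordinal_zero a -> bounded_family XX -> regdec_rank a XX
| regdec_rankS a XX :
    ~ ordinal_zero a ->
    regularly_decomposes
      (fun ZZ => exists b, ordinal_lt b a /\ regdec_rank b ZZ) XX ->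
    regdec_rank a XX.

Definition regdec (R : realType) : collection R :=
  fun XX => exists a : wo_type, countable [set: a] /\ regdec_rank a XX.

(* Main.v *)
Require Import Defs.
From mathcomp Require Import all_boot all_order all_algebra.
From mathcomp Require Import all_classical all_reals.
From mathcomp Require Import ereal topology wochoice.

Set Implicit Arguments.
Unset Strict Implicit.
Unset Printing Implicit Defensive.

Import Order.TTheory GRing.Theory Num.Theory.

Local Open Scope classical_set_scope.
Local Open Scope ring_scope.

(** That the collection of ranked families lies in every stable collection
    containing the bounded families is an induction on the rank
    ([regdec_rank_induction], [regdec_least]).

    The point is the stability of the ranked families ([regdec_stable]).  Let
    [F : XX -> YY] be a coarse map along which the inverse image of each
    bounded subfamily of [YY] has a countable rank.  In general
    there are uncountably many bounded subfamilies, so it is not clear a priori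
    that these ranks have a countable supremum.  But each bounded subfamily
    lies in one of the subfamilies [B_n] formed by all subspaces of diameter
    at most [n].  If [a_n] is a countable rank of the inverse image of [B_n],
    any countable ordinal above all the [a_n] is a rank of [XX], because a
    subfamily of a family of rank [a_n] has rank [a_n] as well.

    Such an ordinal is the ordered sum [s] of the successors of the [a_n]:
    the summand of index [n] contains a copy of [a_n] below its top element.
    This copy is in general not an initial segment of [s], so it does not
    directly give [a_n < s].  Comparing well-orders is avoided by proving that the rank is
    monotone under arbitrary order embeddings ([regdec_rank_embed]): [a_n]
    embeds in the proper initial segment of [s] cut at the top of the [n]-th
    summand, which is therefore a rank of the inverse image of [B_n]. *)

(** * Well-ordered types *)

Section WellOrderedTypes.
Implicit Types a b c : wo_type.

Lemma wo_le_refl a : reflexive (@wo_le a).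
Proof.
have wo : @wo_chain {classic a} (@wo_le a) predT by move=> A _; apply: wo_leP.
by move=> x; apply: (wo_chain_reflexive wo).
Qed.

Lemma wo_le_anti a : antisymmetric (@wo_le a).
Proof.
have wo : @wo_chain {classic a} (@wo_le a) predT by move=> A _; apply: wo_leP.
by move=> x y; apply: (wo_chain_antisymmetric wo).
Qed.

Lemma wo_mono_inj a b (f : b -> a) :
  {mono f : x y / wo_le x y >-> wo_le x y} -> injective f.
Proof.
by move=> fM x y fxy; apply: wo_le_anti; rewrite -!fM fxy wo_le_refl.
Qed.

Lemma nonempty_not_ordinal_zero a (x : a) : ~ ordinal_zero a.
Proof. by move=> a0; have : [set: a] x by []; rewrite a0. Qed.

Lemma ordinal_zero_embed a b (f : b -> a) : ordinal_zero a -> ordinal_zero b.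
Proof.
move=> a0; apply/seteqP; split=> // x _.
by case: (nonempty_not_ordinal_zero (f x)).
Qed.

Lemma well_order_void : @well_order void (fun _ _ => true).
Proof. by move=> A [[]]. Qed.

Definition wo_void : wo_type := WoType well_order_void.

Lemma ordinal_zero_void : ordinal_zero wo_void.
Proof. by apply/seteqP; split=> -[]. Qed.

Lemma ordinal_lt_void a : ~ ordinal_zero a -> ordinal_lt wo_void a.
Proof.
move=> /eqP/set0P[x _].
have [|t [[_ tmin] _]] := @wo_leP a predT; first by exists x.
exists t, (fun v : void => match v with end); split=> [[]//|].
apply/seteqP; split=> [_ [[]]//|y [yt ytN]]; case: ytN.
by apply: wo_le_anti; rewrite yt tmin.
Qed.

Section Segment.
Variables (a : wo_type) (t : a).

Definition seg_type : Type := {x : a | `[< wo_lt x t >]}.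

Definition seg_le : rel seg_type := fun x y => wo_le (val x) (val y).

Lemma seg_well_order : well_order seg_le.
Proof.
apply: antisymmetric_well_order => [x y /wo_le_anti/val_inj//|A [x Ax]].
have [|z [[/asboolP[u Au <-] umin] _]] :=
    @wo_leP a [pred z | `[< exists2 u, u \in A & val u = z >]].
  by exists (val x); apply/asboolP; exists x.
by exists u; split=> // v Av; apply: umin; apply/asboolP; exists v.
Qed.

Definition wo_seg : wo_type := WoType seg_well_order.

Lemma wo_seg_lt : ordinal_lt wo_seg a.
Proof.
exists t, val; split=> //; apply/seteqP; split=> [_ [x _ <-]|x xt].
  by apply/asboolP; case: x.
by exists (exist _ x (asboolT xt)).
Qed.

End Segment.

Section Succ.
Variable a : wo_type.

(** [None] is the added top element. *)
Definition succ_le : rel (option a) := fun x y =>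
  match x, y with
  | _, None => true
  | None, Some _ => false
  | Some u, Some v => wo_le u v
  end.

Lemma succ_well_order : well_order succ_le.
Proof.
apply: antisymmetric_well_order => [[x|] [y|] //= /wo_le_anti->//|A [x Ax]].
have [[u Au]|noA] := pselect (exists u, Some u \in A).
  have [|z [[Az zmin] _]] := @wo_leP a [pred u | Some u \in A].
    by exists u.
  by exists (Some z); split=> // -[v|//] Av; apply: zmin.
exists x; split=> // -[v|] Av; first by case: noA; exists v.
by case: (x).
Qed.

Definition wo_succ : wo_type := WoType succ_well_order.

End Succ.

Section Sum.
Variable a : nat -> wo_type.

(** The lexicographic order: the ordered sum of the [a n], of type omega. *)
Definition sum_le : rel {n & a n} := fun x y =>
  (tag x < tag y)%N
  || (tag x == tag y) && wo_le (tagged x) (tagged_as x y).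

Lemma sum_well_order : well_order sum_le.
Proof.
apply: antisymmetric_well_order => [[n x] [m y]|A [[n x] Ax]].
  rewrite /sum_le /= => /andP[].
  have [//|//|nm] := ltngtP n m; rewrite /= in nm *.
  case: m / nm y => y; rewrite !tagged_asE => xy yx.
  by congr existT; apply: wo_le_anti; rewrite xy yx.
(* Least index met by [A], then least element of [A] in that summand. *)
pose hit k := `[< exists y : a k, Tagged a y \in A >].
have hitA k (y : a k) : Tagged a y \in A -> hit k.
  by move=> Ay; apply/asboolP; exists y.
have [|k /asboolP[y Ay] kmin] := @ex_minnP hit.
  by exists n; apply: hitA Ax.
have [|z [[Az zmin] _]] := @wo_leP (a k) [pred y | Tagged a y \in A].
  by exists y.
exists (Tagged a z); split=> // -[m u] Au; rewrite /sum_le /=.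
have := kmin _ (hitA _ _ Au); rewrite leq_eqVlt => /orP[/eqP km|->//].
case: m / km u Au => u Au.
by rewrite ltnn eqxx tagged_asE; apply: zmin.
Qed.

Definition wo_sum : wo_type := WoType sum_well_order.

End Sum.

Lemma countable_sup (a : nat -> wo_type) :
  (forall n, countable [set: a n]) ->
  countable [set: wo_sum (fun n => wo_succ (a n))].
Proof.
move=> ca; have /all_sig[f finj] n : {f : a n -> nat | injective f}.
  have /countable_injP/cid[f finj] := ca n.
  by exists f; apply: in2TT finj.
apply/countable_injP.
exists (fun z => choice.pickle (tag z, omap (f (tag z)) (tagged z))).
move=> [n x] [m y] _ _ /(pcan_inj choice.pickleK) /= [nm].
case: m / nm y => y.
by case: x y => [x|] [y|] //= [/finj->].
Qed.

(** The cutting point [t] is the top of the [n]-th summand.  The elements of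
    the earlier summands also lie below it, so the embedding is in general not
    onto an initial segment. *)
Lemma lt_sup (a : nat -> wo_type) n :
  let s := wo_sum (fun n => wo_succ (a n)) in
  exists (t : s) (f : a n -> wo_seg t),
    {mono f : x y / wo_le x y >-> wo_le x y}.
Proof.
set s := wo_sum _ => /=.
pose t : s := existT (fun n => wo_succ (a n)) n None.
pose g (x : a n) : s := existT (fun n => wo_succ (a n)) n (Some x).
have gt x : `[< wo_lt (g x) t >].
  apply/asboolP; split; last first.
    move=> gxt; have := wo_le_refl t; rewrite -{2}gxt.
    by rewrite /= /sum_le /= ltnn eqxx tagged_asE.
  by rewrite /= /sum_le /= ltnn eqxx tagged_asE.
exists t, (fun x => exist _ (g x) (gt x)) => x y.
by rewrite /= /seg_le /= /sum_le /= ltnn eqxx tagged_asE.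
Qed.

End WellOrderedTypes.

(** * Bounded families *)

Section BoundedFamilies.
Context {R : realType}.
Implicit Types (XX YY ZZ : metric_family R).

(** An integral bound, so that countably many bounds suffice for all bounded
    families. *)
Lemma bounded_family_leP XX :
  bounded_family XX <->
  exists n : nat, forall X, XX X -> (diam X <= n%:R%:E)%E.
Proof.
split=> [|[n XXn]]; last first.
  apply: (@le_lt_trans _ _ n%:R%:E); last exact: ltry.
  by apply: ub_ereal_sup => _ [X [XXX ->]]; apply: XXn.
rewrite /bounded_family; set s := ereal_sup _ => s_fin.
have [n sn] : exists n : nat, (s <= n%:R%:E)%E.
  case: s s_fin => [r _|//|_]; last by exists 0%N; rewrite leNye.
  exists (Num.truncn r).+1; rewrite lee_fin ltW//.
  exact: truncnS_gt.
exists n => X XXX; apply: le_trans sn.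
by apply: ereal_sup_ubound; exists X.
Qed.

Lemma bounded_family_dominated XX ZZ :
  (forall Z, ZZ Z -> exists2 X, XX X & (diam Z <= diam X)%E) ->
  bounded_family XX -> bounded_family ZZ.
Proof.
move=> dom /bounded_family_leP[n XXn]; apply/bounded_family_leP.
by exists n => Z /dom[X /XXn Xn /le_trans]; apply.
Qed.

Lemma diam_subspace (X : metricType R) (A : set X) :
  (diam (metric_subspace A) <= diam X)%E.
Proof.
apply: ub_ereal_sup => _ [[x y] _ <-].
by apply: ereal_sup_ubound; exists (val x, val y).
Qed.

(** A single piece, the whole space, works at every scale. *)
Lemma finite_asdim_bounded XX : bounded_family XX -> finite_asdim XX.
Proof.
move=> XXb; exists 0%N => r r0; exists (fun _ _ => unit), (fun _ _ _ => setT).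
split=> [X XXX|X XXX i [] []//|].
  by apply/seteqP; split=> // x _; exists ord0 => //; exists tt.
apply: bounded_family_dominated XXb => _ [X [_ [_ [XXX ->]]]].
by exists X => //; apply: diam_subspace.
Qed.

End BoundedFamilies.

(** * Regular decomposition and ranks *)

Section RegularDecomposition.
Context {R : realType}.
Implicit Types (XX YY ZZ : metric_family R) (CC DD : collection R)
  (F : function_family R) (BB : subspace_family R).

Lemma sub_inverse_image F F' BB BB' :
  (forall X Y f, F X Y f -> F' X Y f) -> (forall Y B, BB Y B -> BB' Y B) ->
  forall Z, inverse_image F BB Z -> inverse_image F' BB' Z.
Proof.
move=> sF sB Z [X [Y [f [B [Ff BBB ->]]]]].
by exists X, Y, f, B; split; [apply: sF|apply: sB|].
Qed.

Lemma regularly_decomposes_contained CC DD :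
  contained CC DD ->
  contained (regularly_decomposes CC) (regularly_decomposes DD).
Proof.
move=> CD XX [YY [F [YYfin Fmap Fcoarse CCF]]].
by exists YY, F; split=> // BB YYBB BBb; apply/CD/CCF.
Qed.

(** Restricting a coarse map to a subfamily of its domain shrinks the inverse
    images, whence the hypothesis that [DD] contains the subfamilies of the
    members of [CC]. *)
Lemma regularly_decomposes_sub CC DD XX XX' :
  (forall ZZ ZZ', (forall Z, ZZ' Z -> ZZ Z) -> CC ZZ -> DD ZZ') ->
  (forall X, XX' X -> XX X) ->
  regularly_decomposes CC XX -> regularly_decomposes DD XX'.
Proof.
move=> CD sX [YY [F [YYfin [Fdom Ftot] [rho [rho0 rhoM Frho]] CCF]]].
exists YY, (fun X Y f => F X Y f /\ XX' X); split=> //.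
- split=> [X Y f [/Fdom[_ YYY] XX'X]//|X XX'X].
  by have [Y [f Ff]] := Ftot X (sX X XX'X); exists Y, f.
- by exists rho; split=> // X Y f [Ff _]; apply: Frho.
- move=> BB YYBB BBb; apply: CD (CCF BB YYBB BBb).
  by apply: sub_inverse_image => // X Y f [].
Qed.

(** An indexed predicate, because the equation [f = id] is not well typed for
    [f : X -> Y]. *)
Variant identity_family XX : function_family R :=
  IdentityFamily X of XX X : identity_family XX (fun x : X => x).

(** A bounded family maps to itself by identities, and the inverse image of a
    bounded subfamily is then that subfamily. *)
Lemma bounded_regularly_decomposes CC XX :
  contained (@bounded_family R) CC ->
  bounded_family XX -> regularly_decomposes CC XX.
Proof.
move=> bCC XXb; exists XX, (identity_family XX); split.
- exact: finite_asdim_bounded.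
- split=> [X Y f []//|X XXX].
  by exists X, (fun x => x).
- by exists idfun; split=> // X Y f [].
- move=> BB _ BBb; apply: bCC; apply: bounded_family_dominated BBb.
  move=> _ [X [Y [f [B [fid BBB ->]]]]].
  case: fid B BBB => {X Y f}X _ B BBB.
  by exists (metric_subspace B) => //; exists X, B.
Qed.

(** The recursive occurrence of [regdec_rank] is nested in
    [regularly_decomposes], where the induction principle generated with the
    inductive type provides no hypothesis. *)
Lemma regdec_rank_induction (P : wo_type -> metric_family R -> Prop) :
  (forall a XX, ordinal_zero a -> bounded_family XX -> P a XX) ->
  (forall a XX, ~ ordinal_zero a ->
    regularly_decomposes (fun ZZ => exists b, ordinal_lt b a /\ P b ZZ) XX ->
    P a XX) ->
  forall a XX, regdec_rank a XX -> P a XX.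
Proof.
move=> P0 PS; fix IH 3 => _ _ [a XX a0 XXb|a XX a_gt0].
  exact: P0.
move=> [YY [F [YYfin Fmap Fcoarse CCF]]]; apply: PS => //.
exists YY, F; split=> // BB YYBB BBb.
(* Direct elimination, as the termination check must see that the rank proof
   of the inverse image is a subterm. *)
case: (CCF BB YYBB BBb) => b [ba bZ].
by exists b; split=> //; apply: IH.
Qed.

Lemma regdec_rank_bounded a : contained (@bounded_family R) (@regdec_rank R a).
Proof.
move=> XX XXb; have [a0|a_gt0] := pselect (ordinal_zero a).
  exact: regdec_rank0.
apply: regdec_rankS => //; apply: bounded_regularly_decomposes XXb => ZZ ZZb.
exists wo_void; split; first exact: ordinal_lt_void.
exact: (regdec_rank0 ordinal_zero_void).
Qed.

(** If [c] is isomorphic to the initial segment of [b] below [t], then [g]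
    carries it into the initial segment of [a] below [g t].  So the ordinals
    below [b] that witness the decomposition can be replaced by ordinals
    below [a].  Treating subfamilies in the same induction is what makes the
    hypothesis of [regularly_decomposes_sub] available. *)
Lemma regdec_rank_embed b XX : regdec_rank b XX ->
  forall (a : wo_type) (g : b -> a) XX',
    {mono g : x y / wo_le x y >-> wo_le x y} ->
    (forall X, XX' X -> XX X) -> regdec_rank a XX'.
Proof.
elim/regdec_rank_induction => {b XX} [b XX _ XXb|b XX b_gt0 XXdec];
  move=> a g XX' gM sX.
  apply: regdec_rank_bounded; apply: bounded_family_dominated XXb => X /sX XXX.
  by exists X.
apply: regdec_rankS; first by move/(ordinal_zero_embed g).
apply: regularly_decomposes_sub sX XXdec => ZZ ZZ' sZ [c [[t [f [fM fE]] cZ]]].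
have gft x : `[< wo_lt (g (f x)) (g t) >].
  have [ft ftN] : [set y | wo_lt y t] (f x) by rewrite -fE; exists x.
  by apply/asboolP; split; [rewrite gM|move/(wo_mono_inj gM)].
pose e x : wo_seg (g t) := exist _ (g (f x)) (gft x).
exists (wo_seg (g t)); split; first exact: wo_seg_lt.
apply: (cZ _ e _ _ sZ) => x y.
by rewrite /= /seg_le /= gM fM.
Qed.

(** The exhaustion [B_n] of the bounded subfamilies of [YY]. *)
Definition diam_le_subspaces YY (n : nat) : subspace_family R :=
  fun Y A => YY Y /\ (diam (metric_subspace A) <= n%:R%:E)%E.

Lemma bounded_diam_le_subspaces YY n :
  bounded_family (members_of (diam_le_subspaces YY n)).
Proof.
by apply/bounded_family_leP; exists n => _ [Y [A [[_ An] ->]]].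
Qed.

Lemma bounded_subfamily_diam_le YY BB :
  subfamily YY BB -> bounded_family (members_of BB) ->
  exists n, forall Y B, BB Y B -> diam_le_subspaces YY n B.
Proof.
move=> YYBB /bounded_family_leP[n BBn]; exists n => Y B BBB.
by split; [apply: YYBB BBB|apply: BBn; exists Y, B].
Qed.

Lemma regdec_stable : stable_under_regular_decomposition (@regdec R).
Proof.
move=> XX [YY [F [YYfin Fmap Fcoarse RF]]].
have /choice[a aP] n : exists a : wo_type, countable [set: a] /\
    regdec_rank a (inverse_image F (diam_le_subspaces YY n)).
  by apply: RF; [move=> Y A []|apply: bounded_diam_le_subspaces].
exists (wo_sum (fun n => wo_succ (a n))); split.
  by apply: countable_sup => n; case: (aP n).
apply: regdec_rankS.
  by have [t _] := lt_sup a 0; apply: nonempty_not_ordinal_zero t.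
exists YY, F; split=> // BB YYBB BBb.
have [n BBn] := bounded_subfamily_diam_le YYBB BBb.
have [t [f fM]] := lt_sup a n.
exists (wo_seg t); split; first exact: wo_seg_lt.
apply: (regdec_rank_embed (aP n).2 fM).
exact: sub_inverse_image.
Qed.

Lemma regdec_least CC :
  stable_under_regular_decomposition CC -> contained (@bounded_family R) CC ->
  contained (@regdec R) CC.
Proof.
move=> CCst bCC XX [a [_]].
elim/regdec_rank_induction => {a XX} [_ XX _ /bCC//|a XX _ XXdec].
apply/CCst/(regularly_decomposes_contained _ XXdec) => ZZ [_ [_ ZZC]].
exact: ZZC.
Qed.

End RegularDecomposition.

Theorem proposition2p11 (R : realType) :
  [/\ contained (@bounded_family R) (@regdec R),
      forall XX : metric_family R,
        regularly_decomposes (@regdec R) XX -> regdec XX &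
      forall CC : collection R,
        stable_under_regular_decomposition CC ->
        contained (@bounded_family R) CC ->
        contained (@regdec R) CC].
Proof.
split; [|exact: regdec_stable|exact: regdec_least].
move=> XX XXb; exists wo_void; split; last exact: regdec_rank_bounded.
by rewrite ordinal_zero_void; apply: countable0.
Qed.
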